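(* Let $A$ and $B$ be Leibniz algebras over a field $\mathbb{F}$. Given an extension $0\to A\xrightarrow{\sigma} L\xrightarrow{\pi} B\to 0$ of $A$ by $B$ and a section $T:B\to L$, there exists a unique factor system $(\varphi,\varphi',f)$ of $A$ by $B$ belonging to the extension and $T$.
   Context: All algebras are vector spaces over a fixed field $\mathbb{F}$ with a bilinear multiplication (juxtaposition). A Leibniz algebra is an algebra satisfying $x(yz)=(xy)z+y(xz)$ for all $x,y,z$. $\mathcal{L}(A)$ is the space of linear maps $A\to A$, $\mathrm{Der}(A)\subseteq\mathcal{L}(A)$ the space of derivations ($D(mn)=D(m)n+mD(n)$), and $\mathrm{ad}^l_m n=mn$, $\mathrm{ad}^r_m n=nm$. A factor system of $A$ by $B$ is a tuple $(\varphi,\varphi',f)$ with $\varphi:B\to\mathrm{Der}(A)$ linear, $\varphi':B\to\mathcal{L}(A)$ linear, $f:B\times B\to A$ bilinear, such that for all $m,n\in A$, $i,j,k\in B$: (1) $m(\varphi(i)n)=(\varphi'(i)m)n+\varphi(i)(mn)$; (2) $m(\varphi'(i)n)=\varphi'(i)(mn)+n(\varphi'(i)m)$; (3) $\mathrm{ad}^r_{f(i,j)}+\varphi'(ij)=\varphi'(j)\varphi'(i)+\varphi(i)\varphi'(j)$; (4) $\varphi(i)(mn)=(\varphi(i)m)n+m(\varphi(i)n)$; (5) $\varphi(i)\varphi(j)=\varphi(ij)+\varphi(j)\varphi(i)+\mathrm{ad}^l_{f(i,j)}$; (6) $\varphi(i)\varphi'(j)=\varphi'(j)\varphi(i)+\varphi'(ij)+\mathrm{ad}^r_{f(i,j)}$;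 (7) $f(i,jk)+\varphi(i)f(j,k)=f(ij,k)+\varphi'(k)f(i,j)+f(j,ik)+\varphi(j)f(i,k)$. An extension of $A$ by $B$ is a short exact sequence $0\to A\xrightarrow{\sigma}L\xrightarrow{\pi}B\to0$ with $L$ a Leibniz algebra and $\sigma,\pi$ algebra homomorphisms. A section is a linear map $T:B\to L$ with $\pi T=I_B$. For $x\in L$, $m\in A$ put $P(x)m=\sigma^{-1}(x\sigma(m))$ and $P'(x)m=\sigma^{-1}(\sigma(m)x)$. A factor system $(\varphi,\varphi',f)$ belongs to the extension and $T$ if $\varphi=PT$, $\varphi'=P'T$, and $\sigma(f(i,j))=T(i)T(j)-T(ij)$ for all $i,j\in B$. *)

(* Defs.v *)
From HB Require Import structures.
From mathcomp Require Import all_boot all_order all_algebra.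
From mathcomp Require Import boolp classical_sets functions.

Set Implicit Arguments.
Unset Strict Implicit.
Unset Printing Implicit Defensive.

Import GRing.Theory.
Local Open Scope ring_scope.

(* Algebras are neither associative nor unital, and of arbitrary dimension:
   the ring-based algebra structures of ssralg do not apply. *)
HB.mixin Record Lmodule_isNAAlgebra (F : fieldType) V of GRing.Lmodule F V := {
  amul : V -> V -> V;
  amul_bilinear : bilinear_for *:%R *:%R amul
}.

#[short(type="naAlgType")]
HB.structure Definition NAAlgebra (F : fieldType) :=
  { V of Lmodule_isNAAlgebra F V & GRing.Lmodule F V }.

Notation "x ⋆ y" := (amul x y) (at level 40, left associativity) : ring_scope.

HB.mixin Record NAAlgebra_isLeibniz (F : fieldType) V of NAAlgebra F V := {
  leibnizP : forall x y z : V, x ⋆ (y ⋆ z) = (x ⋆ y) ⋆ z + y ⋆ (x ⋆ z)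
}.

#[short(type="leibnizType")]
HB.structure Definition Leibniz (F : fieldType) :=
  { V of NAAlgebra_isLeibniz F V & NAAlgebra F V }.

Section Adjoint.
Variables (F : fieldType) (A : naAlgType F).

Definition ad_l (m n : A) : A := m ⋆ n.
Definition ad_r (m n : A) : A := n ⋆ m.

Definition derivation (D : A -> A) : Prop :=
  linear D /\ forall m n, D (m ⋆ n) = D m ⋆ n + m ⋆ D n.

End Adjoint.

Section FactorSystem.
Variables (F : fieldType) (A B : leibnizType F).

Record factor_data := FactorData {
  fs_phi : B -> A -> A;
  fs_phi' : B -> A -> A;
  fs_f : B -> B -> A
}.

(* Linearity of a map into the space of linear maps on [A] is stated
   pointwise, as the linear structure there is pointwise. *)
Record factor_system (s : factor_data) : Prop := {
  fs_phi_der : forall i, derivation (fs_phi s i);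
  fs_phi_linear : forall m, linear (fun i => fs_phi s i m);
  fs_phi'_lin : forall i, linear (fs_phi' s i);
  fs_phi'_linear : forall m, linear (fun i => fs_phi' s i m);
  fs_f_bilinear : bilinear_for *:%R *:%R (fs_f s);
  fs_1 : forall (m n : A) (i : B),
    m ⋆ fs_phi s i n = fs_phi' s i m ⋆ n + fs_phi s i (m ⋆ n);
  fs_2 : forall (m n : A) (i : B),
    m ⋆ fs_phi' s i n = fs_phi' s i (m ⋆ n) + n ⋆ fs_phi' s i m;
  fs_3 : forall i j : B,
    ad_r (fs_f s i j) \+ fs_phi' s (i ⋆ j)
      =1 (fs_phi' s j \o fs_phi' s i) \+ (fs_phi s i \o fs_phi' s j);
  fs_4 : forall (m n : A) (i : B),
    fs_phi s i (m ⋆ n) = fs_phi s i m ⋆ n + m ⋆ fs_phi s i n;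
  fs_5 : forall i j : B,
    fs_phi s i \o fs_phi s j
      =1 fs_phi s (i ⋆ j) \+ (fs_phi s j \o fs_phi s i) \+ ad_l (fs_f s i j);
  fs_6 : forall i j : B,
    fs_phi s i \o fs_phi' s j
      =1 (fs_phi' s j \o fs_phi s i) \+ fs_phi' s (i ⋆ j) \+ ad_r (fs_f s i j);
  fs_7 : forall i j k : B,
    fs_f s i (j ⋆ k) + fs_phi s i (fs_f s j k)
      = fs_f s (i ⋆ j) k + fs_phi' s k (fs_f s i j)
        + fs_f s j (i ⋆ k) + fs_phi s j (fs_f s i k)
}.

End FactorSystem.

Section Extension.
Variables (F : fieldType) (A B L : leibnizType F).
Variables (sigma : {linear A -> L}) (pi : {linear L -> B}).

Record extension : Prop := {
  ext_sigmaM : {morph sigma : x y / x ⋆ y};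
  ext_piM : {morph pi : x y / x ⋆ y};
  ext_inj : injective sigma;
  ext_exact : range sigma = [set x | pi x = 0]%classic;
  ext_surj : range pi = [set: B]%classic
}.

(* Takes the value 0 outside the range of [sigma]; for an extension, the
   arguments below lie in this range, which is an ideal of [L]. *)
Definition sigma_inv : L -> A := 'pinv_(fun=> 0) [set: A]%classic sigma.

Definition P (x : L) (m : A) : A := sigma_inv (x ⋆ sigma m).
Definition P' (x : L) (m : A) : A := sigma_inv (sigma m ⋆ x).

Definition is_section (T : {linear B -> L}) : Prop := pi \o T =1 id.

Record belongs_to (T : {linear B -> L}) (s : factor_data A B) : Prop := {
  belongs_phi : fs_phi s = P \o T;
  belongs_phi' : fs_phi' s = P' \o T;
  belongs_f : forall i j, sigma (fs_f s i j) = T i ⋆ T j - T (i ⋆ j)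
}.

End Extension.

(* Main.v *)
Require Import Defs.
From mathcomp Require Import all_boot all_order all_algebra.
From mathcomp Require Import boolp classical_sets functions.
Import GRing.Theory.
Local Open Scope ring_scope.

(** Since [sigma] is injective, an identity in [A] may be checked after applying
    [sigma], where everything takes place inside the single Leibniz algebra [L].
    There the three candidates act by multiplication:
    [sigma (P x m) = x ⋆ sigma m], [sigma (P' x m) = sigma m ⋆ x] and
    [sigma (f i j) = T i ⋆ T j - T (i ⋆ j)]; that the right-hand sides lie in the
    range of [sigma], so that [sigma_inv] does invert [sigma] on them, is
    exactness, since [pi] kills them ([sigma_P], [sigma_P'], [sigma_cocycle]).

    Under this dictionary each identity of a factor system is one instance of
    the Leibniz identity of [L].  [fs_1], [fs_2] and [fs_4] are the instances
    with two arguments in the image of [A] and one in that of [T]; [fs_3],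
    [fs_5] and [fs_6] those with one argument in the image of [A], once
    [T i ⋆ T j] is written as [sigma (f i j) + T (i ⋆ j)]; [fs_7] is the instance
    with arguments [T i], [T j], [T k], from which the image under [T] of the
    Leibniz identity of [B] is subtracted.

    Uniqueness holds because belonging prescribes [phi] and [phi'] outright,
    and prescribes [f] after applying the injective map [sigma]. *)

(** * Multiplication in a nonassociative algebra *)

Section NonassociativeAlgebra.
Set Implicit Arguments.
Variables (F : fieldType) (V : naAlgType F).
Implicit Types (a : F) (x y z : V).

Lemma amulDZl a x y z : (a *: x + y) ⋆ z = a *: (x ⋆ z) + y ⋆ z.
Proof. by case: (@amul_bilinear F V) => h _; exact: h. Qed.

Lemma amulDZr a x y z : z ⋆ (a *: x + y) = a *: (z ⋆ x) + z ⋆ y.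
Proof. by case: (@amul_bilinear F V) => _ h; exact: h. Qed.

Lemma amulDl x y z : (x + y) ⋆ z = x ⋆ z + y ⋆ z.
Proof. by rewrite -[x in LHS]scale1r amulDZl scale1r. Qed.

Lemma amulDr x y z : z ⋆ (x + y) = z ⋆ x + z ⋆ y.
Proof. by rewrite -[x in LHS]scale1r amulDZr scale1r. Qed.

Lemma amulBl x y z : (x - y) ⋆ z = x ⋆ z - y ⋆ z.
Proof. by rewrite addrC -scaleN1r amulDZl scaleN1r addrC. Qed.

Lemma amulBr x y z : z ⋆ (x - y) = z ⋆ x - z ⋆ y.
Proof. by rewrite addrC -scaleN1r amulDZr scaleN1r addrC. Qed.

Lemma amul0l x : 0 ⋆ x = 0.
Proof. by rewrite -[X in X ⋆ _](subrr x) amulBl subrr. Qed.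

Lemma amul0r x : x ⋆ 0 = 0.
Proof. by rewrite -[X in _ ⋆ X](subrr x) amulBr subrr. Qed.

End NonassociativeAlgebra.

(** * The factor system of a section *)

Section FactorSystemOfSection.
Set Implicit Arguments.
Variables (F : fieldType) (A B L : leibnizType F).
Variables (sigma : {linear A -> L}) (pi : {linear L -> B}).
Hypothesis hE : extension sigma pi.

Lemma pi_sigma m : pi (sigma m) = 0.
Proof.
have : range sigma (sigma m) by exists m.
by rewrite (ext_exact hE).
Qed.

Lemma sigma_invK y : pi y = 0 -> sigma (sigma_inv sigma y) = y.
Proof.
move=> py0; apply: (@pinvK _ _ (fun=> 0) [set: A]%classic sigma).
by rewrite inE (ext_exact hE).
Qed.

(** The range of [sigma] is the kernel of [pi], hence an ideal of [L]. *)
Lemma sigma_P x m : sigma (P sigma x m) = x ⋆ sigma m.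
Proof. by rewrite sigma_invK // (ext_piM hE) pi_sigma amul0r. Qed.

Lemma sigma_P' x m : sigma (P' sigma x m) = sigma m ⋆ x.
Proof. by rewrite sigma_invK // (ext_piM hE) pi_sigma amul0l. Qed.

Variable T : {linear B -> L}.
Hypothesis hT : is_section pi T.

(** The failure of the section [T] to be multiplicative, read in [A]. *)
Definition cocycle (i j : B) : A := sigma_inv sigma (T i ⋆ T j - T (i ⋆ j)).

Lemma sigma_cocycle i j : sigma (cocycle i j) = T i ⋆ T j - T (i ⋆ j).
Proof.
have piT k : pi (T k) = k by exact: hT.
by rewrite sigma_invK // linearB /= (ext_piM hE) !piT subrr.
Qed.

Definition section_data : factor_data A B :=
  FactorData (P sigma \o T) (P' sigma \o T) cocycle.

Let sigmaE := (linearD sigma, linearZ_LR sigma, ext_sigmaM hE,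
  sigma_P, sigma_P', sigma_cocycle).

Lemma cocycle_bilinear : bilinear_for *:%R *:%R cocycle.
Proof.
split=> k a x y; apply: (ext_inj hE); rewrite /= !sigmaE /=.
- by rewrite amulDZl !linearP /= amulDZl scalerBr scalerN addrACA.
- by rewrite amulDZr !linearP /= amulDZr scalerBr scalerN addrACA.
Qed.

(** The Leibniz identity for [T i], [T j], [T k], minus the image under [T] of
    the one for [i], [j], [k]: expanding the cocycles also produces products such
    as [T i ⋆ T (j ⋆ k)], which cancel in pairs. *)
Lemma cocycle_identity i j k :
  cocycle i (j ⋆ k) + P sigma (T i) (cocycle j k)
    = cocycle (i ⋆ j) k + P' sigma (T k) (cocycle i j)
      + cocycle j (i ⋆ k) + P sigma (T j) (cocycle i k).
Proof.
apply: (ext_inj hE); rewrite !sigmaE !amulBr amulBl.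
have cancel (a b c : L) : (a - b) + (c - a) = c - b by rewrite addrC subrKA.
(* Grouping the right-hand side in pairs puts next to each other the two terms
   that share, with opposite signs, the same mixed product. *)
rewrite -[in RHS]addrA !cancel (leibnizP i) (leibnizP (T i)) linearD /=.
by rewrite opprD addrACA.
Qed.

Lemma section_data_factor_system : factor_system section_data.
Proof.
split=> /=.
- move=> i; split=> [a m n|m n]; apply: (ext_inj hE); rewrite !sigmaE.
  + by rewrite amulDZr.
  + by rewrite leibnizP.
- by move=> m a i j; apply: (ext_inj hE); rewrite /= !sigmaE linearP amulDZl.
- by move=> i a m n; apply: (ext_inj hE); rewrite !sigmaE amulDZl.
- by move=> m a i j; apply: (ext_inj hE); rewrite /= !sigmaE linearP amulDZr.
- exact: cocycle_bilinear.
- by move=> m n i; apply: (ext_inj hE); rewrite !sigmaE leibnizP.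
- by move=> m n i; apply: (ext_inj hE); rewrite !sigmaE leibnizP.
- move=> i j m; apply: (ext_inj hE); rewrite /= !sigmaE.
  by rewrite -amulDr subrK leibnizP.
- by move=> m n i; apply: (ext_inj hE); rewrite !sigmaE leibnizP.
- move=> i j m; apply: (ext_inj hE); rewrite /= !sigmaE.
  by rewrite addrAC -amulDl [T (i ⋆ j) + _]addrC subrK leibnizP.
- move=> i j m; apply: (ext_inj hE); rewrite /= !sigmaE.
  by rewrite -addrA -amulDr [T (i ⋆ j) + _]addrC subrK leibnizP.
- exact: cocycle_identity.
Qed.

Lemma section_data_belongs : belongs_to sigma T section_data.
Proof. by split=> // i j; exact: sigma_cocycle. Qed.

Lemma belongs_to_inj s t :
  belongs_to sigma T s -> belongs_to sigma T t -> s = t.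
Proof.
case: s t => [p p' f] [q q' g] [/= -> -> hf] [/= -> -> hg].
congr FactorData; apply/funext => i; apply/funext => j.
by apply: (ext_inj hE); rewrite hf hg.
Qed.

End FactorSystemOfSection.

Theorem theorem3p1 (F : fieldType) (A B L : leibnizType F)
    (sigma : {linear A -> L}) (pi : {linear L -> B})
    (hE : extension sigma pi)
    (T : {linear B -> L}) (hT : is_section pi T) :
  exists! s : factor_data A B, factor_system s /\ belongs_to sigma T s.
Proof.
have hB := section_data_belongs hE hT.
exists (section_data sigma T); split.
- by split=> //; exact: (section_data_factor_system hE hT).
- by move=> s [_ hs]; exact: (belongs_to_inj hE hB hs).
Qed.
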